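(* Let $(A,\mu_{\alpha,\beta},R_\omega,p_\omega,q_\omega)_{\alpha,\beta,\omega\in\Omega}$ be a Rota-Baxter family BiHom-$\Omega$-associative algebra of weight $\lambda$, and let $(\mu^t_{\alpha,\beta},R^t_\omega)_{\alpha,\beta,\omega\in\Omega}$, $\mu^t_{\alpha,\beta}=\sum_{i\ge0}\mu^i_{\alpha,\beta}t^i$, $R^t_\omega=\sum_{i\ge0}R^i_\omega t^i$, be a 1-parameter formal deformation of it. Then $(\mu^1_{\alpha,\beta},R^1_\omega)_{\alpha,\beta,\omega\in\Omega}$ is a 2-cocycle in the cochain complex $\mathrm{C}^\bullet_{\mathrm{RBFA}_\lambda}(A)$.
   Context: $\mathbf{k}$ is a commutative unitary ring (the base ring for all vector spaces and linear maps), $\lambda\in\mathbf{k}$, and $\Omega$ is a semigroup with unit $1$. Two families of linear endomorphisms $(p_\omega),(q_\omega)$ are commuting if $p_\alpha\circ q_\beta=q_\beta\circ p_\alpha$ for all $\alpha,\beta\in\Omega$. A BiHom-$\Omega$-associative algebra $(A,\mu_{\alpha,\beta},p_\omega,q_\omega)$ is a vector space $A$ with two commuting families of linear maps $p_\omega,q_\omega:A\to A$ and bilinear maps $\mu_{\alpha,\beta}:A\otimes A\to A$ such that for all $x,y,z\in A$, $\alpha,\beta,\gamma\in\Omega$: $p_{\alpha\beta}\mu_{\alpha,\beta}(x,y)=\mu_{\alpha,\beta}(p_\alpha(x),p_\beta(y))$, $q_{\alpha\beta}\mu_{\alpha,\beta}(x,y)=\mu_{\alpha,\beta}(q_\alpha(x),q_\beta(y))$,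 $\mu_{\alpha,\beta\gamma}(p_\alpha(x),\mu_{\beta,\gamma}(y,z))=\mu_{\alpha\beta,\gamma}(\mu_{\alpha,\beta}(x,y),q_\gamma(z))$. It is a Rota-Baxter family BiHom-$\Omega$-associative algebra of weight $\lambda$ when equipped with linear maps $R_\omega:A\to A$ with $p_\alpha R_\alpha=R_\alpha p_\alpha$, $q_\alpha R_\alpha=R_\alpha q_\alpha$, and $\mu_{\alpha,\beta}(R_\alpha(x),R_\beta(y))=R_{\alpha\beta}\big(\mu_{\alpha,\beta}(R_\alpha(x),y)+\mu_{\alpha,\beta}(x,R_\beta(y))+\lambda\mu_{\alpha,\beta}(x,y)\big)$. Cochains: $\mathrm{C}^1_\Omega(A)$ is the space of families of linear maps $h_\alpha:A\to A$ with $p_\alpha h_\alpha=h_\alpha p_\alpha$, $q_\alpha h_\alpha=h_\alpha q_\alpha$; $\mathrm{C}^1_{\mathrm{RBF}_\lambda}(A)$ is the same space; $\mathrm{C}^2_\Omega(A)$ is the space of families of bilinear maps $f_{\alpha,\beta}:A\otimes A\to A$ with $p_{\alpha\beta}f_{\alpha,\beta}=f_{\alpha,\beta}(p_\alpha\otimes p_\beta)$, $q_{\alpha\beta}f_{\alpha,\beta}=f_{\alpha,\beta}(q_\alpha\otimes q_\beta)$; $\mathrm{C}^2_{\mathrm{RBFA}_\lambda}(A)=\mathrm{C}^2_\Omega(A)\oplus\mathrm{C}^1_{\mathrm{RBF}_\lambda}(A)$. A pair $(f,h)\in\mathrm{C}^2_{\mathrm{RBFA}_\lambda}(A)$ is a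 2-cocycle if $\delta^2_{\mathrm{Alg}}f=0$ and $-\partial^1h-\Phi^2f=0$, where $(\delta^2_{\mathrm{Alg}}f)_{\alpha,\beta,\gamma}(a,b,c)=\mu_{\alpha,\beta\gamma}(p_\alpha(a),f_{\beta,\gamma}(b,c))-f_{\alpha\beta,\gamma}(\mu_{\alpha,\beta}(a,b),q_\gamma(c))+f_{\alpha,\beta\gamma}(p_\alpha(a),\mu_{\beta,\gamma}(b,c))-\mu_{\alpha\beta,\gamma}(f_{\alpha,\beta}(a,b),q_\gamma(c))$; $(\partial^1h)_{\alpha,\beta}(a,b)=\mu_{\alpha,\beta}(R_\alpha(a),h_\beta(b))-R_{\alpha\beta}\mu_{\alpha,\beta}(a,h_\beta(b))-h_{\alpha\beta}\big(\mu_{\alpha,\beta}(a,R_\beta(b))+\mu_{\alpha,\beta}(R_\alpha(a),b)+\lambda\mu_{\alpha,\beta}(a,b)\big)+\mu_{\alpha,\beta}(h_\alpha(a),R_\beta(b))-R_{\alpha\beta}\mu_{\alpha,\beta}(h_\alpha(a),b)$; $(\Phi^2f)_{\alpha,\beta}(a,b)=f_{\alpha,\beta}(R_\alpha(a),R_\beta(b))-R_{\alpha\beta}\big(\lambda f_{\alpha,\beta}(a,b)+f_{\alpha,\beta}(R_\alpha(a),b)+f_{\alpha,\beta}(a,R_\beta(b))\big)$. A 1-parameter formal deformation of $A$ is a pair of families of power series $\mu^t_{\alpha,\beta}=\sum_{i\ge0}\mu^i_{\alpha,\beta}t^i$ with $(\mu^i_{\alpha,\beta})\in\mathrm{C}^2_\Omega(A)$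 and $R^t_\omega=\sum_{i\ge0}R^i_\omega t^i$ with $(R^i_\omega)\in\mathrm{C}^1_{\mathrm{RBF}_\lambda}(A)$, such that $\mu^0_{\alpha,\beta}=\mu_{\alpha,\beta}$, $R^0_\omega=R_\omega$ and $(A[[t]],\mu^t_{\alpha,\beta},R^t_\omega,p_\omega,q_\omega)$ is a Rota-Baxter family BiHom-$\Omega$-associative algebra of weight $\lambda$ over $\mathbf{k}[[t]]$ (maps extended $\mathbf{k}[[t]]$-linearly). *)

(* Defs.v *)
From HB Require Import structures.
From mathcomp Require Import all_boot all_order all_algebra.
From mathcomp Require Import boolp.

Set Implicit Arguments.
Unset Strict Implicit.
Unset Printing Implicit Defensive.

Import GRing.Theory.
Local Open Scope ring_scope.

(* [fps T] is T[[t]]. *)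

Record fps (T : Type) : Type := Fps { fcoef : nat -> T }.

Lemma fpsP (T : Type) (x y : fps T) : fcoef x =1 fcoef y -> x = y.
Proof. by case: x y => x [y] /= /funext ->. Qed.

HB.instance Definition _ (T : Type) := gen_eqMixin (fps T).
HB.instance Definition _ (T : Type) := gen_choiceMixin (fps T).

Section Zmodule.
Variable V : zmodType.
Implicit Types x y z : fps V.

Definition fps_zero : fps V := Fps (fun=> 0).
Definition fps_opp x : fps V := Fps (fun n => - fcoef x n).
Definition fps_add x y : fps V := Fps (fun n => fcoef x n + fcoef y n).

Fact fps_addA : associative fps_add.
Proof. by move=> x y z; apply: fpsP => n /=; rewrite addrA. Qed.
Fact fps_addC : commutative fps_add.
Proof. by move=> x y; apply: fpsP => n /=; rewrite addrC. Qed.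
Fact fps_add0 : left_id fps_zero fps_add.
Proof. by move=> x; apply: fpsP => n /=; rewrite add0r. Qed.
Fact fps_addN : left_inverse fps_zero fps_opp fps_add.
Proof. by move=> x; apply: fpsP => n /=; rewrite addNr. Qed.

HB.instance Definition _ := GRing.isZmodule.Build (fps V)
  fps_addA fps_addC fps_add0 fps_addN.
End Zmodule.

Definition fpsC (V : zmodType) (a : V) : fps V :=
  Fps (fun n => if n == 0%N then a else 0).

(* The Cauchy product of a series of scalars and a series of vectors; the
   multiplication of k[[t]] is the case A = k^o. *)
Definition fps_scale (k : comPzRingType) (A : lmodType k)
    (a : fps k) (x : fps A) : fps A :=
  Fps (fun n => \sum_(i < n.+1) fcoef a i *: fcoef x (n - i)).

Definition fps_mul (k : comPzRingType) (a b : fps k) : fps k :=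
  Fps (fun n => \sum_(i < n.+1) fcoef a i * fcoef b (n - i)).

Section CauchyProduct.
Variables (k : comPzRingType) (A : lmodType k).
Implicit Types (a b : fps k) (x y : fps A).

Fact fps_scaleA a b x : fps_scale a (fps_scale b x) = fps_scale (fps_mul a b) x.
Proof.
apply: fpsP => n /=.
pose F j l := (fcoef a j * fcoef b l) *: fcoef x (n - j - l).
transitivity (\sum_(j < n.+1) \sum_(l < n.+1 | (l <= n - j)%N) F j l).
  apply: eq_bigr => j _; rewrite scaler_sumr (big_ord_narrow_leq (leq_subr _ _)).
  by apply: eq_bigr => l _; rewrite scalerA.
rewrite [RHS](eq_bigr (fun i : 'I_n.+1 =>
    \sum_(j < n.+1 | (j <= i)%N) F j (i - j)%N)); last first.
  move=> i _; rewrite scaler_suml (big_ord_narrow_leq (ltnSE (ltn_ord i))).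
  apply: eq_bigr => j _ /=; rewrite /F -subnDA subnKC //.
  by rewrite -ltnS ltn_ord.
rewrite [RHS](exchange_big_dep predT) //=; apply: eq_bigr => j _.
rewrite (big_ord_narrow_leq (leq_subr _ _)) /=.
rewrite -(big_mkord xpredT (fun l => F j l)).
rewrite -(big_mkord (fun i => (j <= i)%N) (fun i => F j (i - j)%N)).
rewrite [RHS](big_cat_nat _ (n := j)) //=; last by apply: ltnW; apply: ltn_ord.
rewrite [X in _ = X + _]big_nat_cond [X in _ = X + _]big_pred0 ?add0r; last first.
  by move=> i /=; case: (ltnP i j) => //=; rewrite andbF.
rewrite -[X in \sum_(X <= _ < n.+1 | _) _]add0n big_addn.
rewrite subSn; last by rewrite -ltnS ltn_ord.
rewrite [RHS]big_mkcond; apply: eq_bigr => i _.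
by rewrite leq_addl addnK.
Qed.

Fact fps_scale1 x : fps_scale (fpsC 1) x = x.
Proof.
apply: fpsP => n /=; rewrite big_ord_recl /= subn0 scale1r big1 ?addr0 // => i _.
by rewrite scale0r.
Qed.

Fact fps_scaleDr : right_distributive (@fps_scale k A) +%R.
Proof.
move=> a x y; apply: fpsP => n /=; rewrite -big_split.
by apply: eq_bigr => i _; rewrite scalerDr.
Qed.

Fact fps_scaleDl x : {morph (@fps_scale k A)^~ x : a b / a + b}.
Proof.
move=> a b; apply: fpsP => n /=; rewrite -big_split.
by apply: eq_bigr => i _; rewrite scalerDl.
Qed.
End CauchyProduct.

Section Ring.
Variable k : comPzRingType.

Fact fps_mulA : associative (@fps_mul k).
Proof. by move=> a b c; have := @fps_scaleA k k^o a b c. Qed.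
Fact fps_mulC : commutative (@fps_mul k).
Proof.
move=> a b; apply: fpsP => n /=; rewrite (reindex_inj rev_ord_inj) /=.
apply: eq_bigr => i _; rewrite subSS subKn 1?mulrC //.
by rewrite -ltnS ltn_ord.
Qed.
Fact fps_mul1 : left_id (fpsC 1) (@fps_mul k).
Proof. exact: (@fps_scale1 k k^o). Qed.
Fact fps_mulDl : left_distributive (@fps_mul k) +%R.
Proof. by move=> a b x; apply: (@fps_scaleDl k k^o x a b). Qed.

HB.instance Definition _ := GRing.Zmodule_isComPzRing.Build (fps k)
  fps_mulA fps_mulC fps_mul1 fps_mulDl.
End Ring.

HB.instance Definition _ (k : comPzRingType) (A : lmodType k) :=
  GRing.Zmodule_isLmodule.Build (fps k) (fps A)
    (@fps_scaleA k A) (@fps_scale1 k A) (@fps_scaleDr k A) (@fps_scaleDl k A).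

(* k[[t]]-linear extension to A[[t]] of a series of linear, resp. bilinear,
   maps on A; a single map is regarded as a series concentrated in degree 0. *)
Definition fps_ext0 (A : Type) (f : A -> A) (x : fps A) : fps A :=
  Fps (fun n => f (fcoef x n)).

Definition fps_ext1 (A : zmodType) (f : nat -> A -> A) (x : fps A) : fps A :=
  Fps (fun n => \sum_(i < n.+1) f i (fcoef x (n - i))).

Definition fps_ext2 (A : zmodType) (f : nat -> A -> A -> A) (x y : fps A) :
    fps A :=
  Fps (fun n => \sum_(i < n.+1) \sum_(j < (n - i).+1)
                  f i (fcoef x j) (fcoef y (n - i - j))).

(* [bilinear_for] of the library asks for 1 != 0 in the base ring. *)
Definition bilinear_map (k : pzRingType) (A : lmodType k) (f : A -> A -> A) :
    Prop :=
  (forall y, linear (f^~ y)) /\ (forall x, linear (f x)).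

Section Algebra.
Variables (k : comPzRingType) (Omega : monoidType) (A : lmodType k).
Variable lambda : k.
Implicit Types (mu f : Omega -> Omega -> A -> A -> A).
Implicit Types (R p q h : Omega -> A -> A).
Implicit Types (al be ga : Omega).

Record is_BiHomOmega_assoc mu p q : Prop := {
  bho_p_linear : forall al, linear (p al);
  bho_q_linear : forall al, linear (q al);
  bho_mu_bilinear : forall al be, bilinear_map (mu al be);
  bho_pq_comm : forall al be x, p al (q be x) = q be (p al x);
  bho_p_mu : forall al be x y,
    p (al * be)%g (mu al be x y) = mu al be (p al x) (p be y);
  bho_q_mu : forall al be x y,
    q (al * be)%g (mu al be x y) = mu al be (q al x) (q be y);
  bho_assoc : forall al be ga x y z,
    mu al (be * ga)%g (p al x) (mu be ga y z)
      = mu (al * be)%g ga (mu al be x y) (q ga z)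
}.

Record is_RBF_BiHomOmega_assoc mu R p q : Prop := {
  rbf_assoc : is_BiHomOmega_assoc mu p q;
  rbf_R_linear : forall al, linear (R al);
  rbf_pR : forall al x, p al (R al x) = R al (p al x);
  rbf_qR : forall al x, q al (R al x) = R al (q al x);
  rbf_RB : forall al be x y,
    mu al be (R al x) (R be y)
      = R (al * be)%g
          (mu al be (R al x) y + mu al be x (R be y) + lambda *: mu al be x y)
}.

Record in_C1 p q h : Prop := {
  C1_linear : forall al, linear (h al);
  C1_p : forall al x, p al (h al x) = h al (p al x);
  C1_q : forall al x, q al (h al x) = h al (q al x)
}.

Record in_C2 p q f : Prop := {
  C2_bilinear : forall al be, bilinear_map (f al be);
  C2_p : forall al be x y,
    p (al * be)%g (f al be x y) = f al be (p al x) (p be y);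
  C2_q : forall al be x y,
    q (al * be)%g (f al be x y) = f al be (q al x) (q be y)
}.

Definition delta2_Alg mu p q f al be ga (a b c : A) : A :=
  mu al (be * ga)%g (p al a) (f be ga b c)
  - f (al * be)%g ga (mu al be a b) (q ga c)
  + f al (be * ga)%g (p al a) (mu be ga b c)
  - mu (al * be)%g ga (f al be a b) (q ga c).

Definition partial1 mu R h al be (a b : A) : A :=
  mu al be (R al a) (h be b)
  - R (al * be)%g (mu al be a (h be b))
  - h (al * be)%g
      (mu al be a (R be b) + mu al be (R al a) b + lambda *: mu al be a b)
  + mu al be (h al a) (R be b)
  - R (al * be)%g (mu al be (h al a) b).

Definition Phi2 R f al be (a b : A) : A :=
  f al be (R al a) (R be b)
  - R (al * be)%g
      (lambda *: f al be a b + f al be (R al a) b + f al be a (R be b)).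

Record is_2cocycle_RBFA mu R p q f h : Prop := {
  cocycle_C2 : in_C2 p q f;
  cocycle_C1 : in_C1 p q h;
  cocycle_Alg : forall al be ga a b c, delta2_Alg mu p q f al be ga a b c = 0;
  cocycle_RBF : forall al be a b,
    - partial1 mu R h al be a b - Phi2 R f al be a b = 0
}.
End Algebra.

(* [mut i] and [Rt i] are the coefficients of t^i. *)
Record is_formal_deformation (k : comPzRingType) (Omega : monoidType)
    (A : lmodType k) (lambda : k)
    (mu : Omega -> Omega -> A -> A -> A) (R p q : Omega -> A -> A)
    (mut : nat -> Omega -> Omega -> A -> A -> A)
    (Rt : nat -> Omega -> A -> A) : Prop := {
  def_mu_C2 : forall i, in_C2 p q (mut i);
  def_R_C1 : forall i, in_C1 p q (Rt i);
  def_mu0 : forall al be x y, mut 0%N al be x y = mu al be x y;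
  def_R0 : forall w x, Rt 0%N w x = R w x;
  def_RBF : @is_RBF_BiHomOmega_assoc (fps k) Omega (fps A) (fpsC lambda)
    (fun al be => fps_ext2 (fun i => mut i al be))
    (fun w => fps_ext1 (fun i => Rt i w))
    (fun w => fps_ext0 (p w))
    (fun w => fps_ext0 (q w))
}.

(* Main.v *)
Require Import Defs.
From mathcomp Require Import all_boot all_order all_algebra.

Import GRing.Theory.
Local Open Scope ring_scope.

(** Each axiom of the deformed structure on A[[t]], applied to constant series,
is an identity of power series with values in A, and the 2-cocycle conditions
are the coefficients of t in two of these identities.

The coefficient of t in a composite of series of multilinear maps obeys the
Leibniz rule: it is the sum of the terms in which exactly one factor is taken
in degree 1 and all others in degree 0. For the BiHom-associativity of [mut]
this gives two terms on each side, since [p] and [q] are concentrated in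
degree 0; their difference is [delta2_Alg] of [mut 1]. For the Rota-Baxter
identity, the terms in which [mut 1] occurs form [Phi2], those in which [Rt 1]
occurs form [partial1], and the two sides balance exactly when the sum of both
vanishes. That [mut 1] and [Rt 1] are cochains is part of the definition of a
deformation.

The lemmas [fps_ext1_coef1] and [fps_ext2_coef1] are the Leibniz rule for one
application of a linear and of a bilinear map. *)

Section LowCoefficients.
Variables (k : comPzRingType) (A : lmodType k).
Implicit Types (x y : fps A).

Lemma fpsC_coef0 (V : zmodType) (a : V) : fcoef (fpsC a) 0 = a.
Proof. by []. Qed.

Lemma fpsC_coef1 (V : zmodType) (a : V) : fcoef (fpsC a) 1 = 0.
Proof. by []. Qed.

Lemma fps_add_coef x y n : fcoef (x + y) n = fcoef x n + fcoef y n.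
Proof. by []. Qed.

Lemma fps_ext0_coef (f : A -> A) x n : fcoef (fps_ext0 f x) n = f (fcoef x n).
Proof. by []. Qed.

Lemma fpsC_scale_coef (a : k) x n :
  fcoef (fpsC a *: x) n = a *: fcoef x n.
Proof.
rewrite [LHS]/= big_ord_recl /= subn0 big1 ?addr0 // => i _.
by rewrite scale0r.
Qed.

Lemma fps_ext1_coef0 (f : nat -> A -> A) x :
  fcoef (fps_ext1 f x) 0 = f 0%N (fcoef x 0).
Proof. by rewrite /= big_ord1. Qed.

Lemma fps_ext1_coef1 (f : nat -> A -> A) x :
  fcoef (fps_ext1 f x) 1 = f 0%N (fcoef x 1) + f 1%N (fcoef x 0).
Proof. by rewrite /= big_ord_recl big_ord1. Qed.

Lemma fps_ext2_coef0 (f : nat -> A -> A -> A) x y :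
  fcoef (fps_ext2 f x y) 0 = f 0%N (fcoef x 0) (fcoef y 0).
Proof. by rewrite /= !big_ord1. Qed.

Lemma fps_ext2_coef1 (f : nat -> A -> A -> A) x y :
  fcoef (fps_ext2 f x y) 1 =
    f 0%N (fcoef x 0) (fcoef y 1) + f 0%N (fcoef x 1) (fcoef y 0)
    + f 1%N (fcoef x 0) (fcoef y 0).
Proof. by rewrite /= big_ord_recl big_ord1 /= big_ord_recl !big_ord1. Qed.

End LowCoefficients.

Definition fps_coef01 := (fps_add_coef, fpsC_scale_coef, fps_ext0_coef,
  fps_ext1_coef0, fps_ext1_coef1, fps_ext2_coef0, fps_ext2_coef1,
  fpsC_coef0, fpsC_coef1).

Section LinearMaps.
Variables (k : comPzRingType) (A : lmodType k).

Lemma linear_map_add (f : A -> A) : linear f -> {morph f : x y / x + y}.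
Proof. by move=> lf x y; have := lf 1 x y; rewrite !scale1r. Qed.

Lemma linear_map_0 (f : A -> A) : linear f -> f 0 = 0.
Proof.
by move=> /linear_map_add/(_ 0 0)/eqP; rewrite addr0 eq_sym -subr_eq0 addrK => /eqP.
Qed.

Lemma bilinear_map_0l (f : A -> A -> A) y : bilinear_map f -> f 0 y = 0.
Proof. by case=> + _ => /(_ y)/linear_map_0. Qed.

Lemma bilinear_map_0r (f : A -> A -> A) x : bilinear_map f -> f x 0 = 0.
Proof. by case=> _ /(_ x)/linear_map_0. Qed.

End LinearMaps.

Section Infinitesimal.
Variables (k : comPzRingType) (Omega : monoidType) (A : lmodType k).
Variable lambda : k.
Variables (mu : Omega -> Omega -> A -> A -> A) (R p q : Omega -> A -> A).
Variables (mut : nat -> Omega -> Omega -> A -> A -> A).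
Variables (Rt : nat -> Omega -> A -> A).
Hypothesis rbfA : is_RBF_BiHomOmega_assoc lambda mu R p q.
Hypothesis deformA : is_formal_deformation lambda mu R p q mut Rt.

Let assocA := rbf_assoc rbfA.
Let mu0l al be y : mu al be 0 y = 0.
Proof. exact/bilinear_map_0l/(bho_mu_bilinear assocA). Qed.
Let mu0r al be x : mu al be x 0 = 0.
Proof. exact/bilinear_map_0r/(bho_mu_bilinear assocA). Qed.
Let p0 al : p al 0 = 0.
Proof. exact/linear_map_0/(bho_p_linear assocA). Qed.
Let q0 al : q al 0 = 0.
Proof. exact/linear_map_0/(bho_q_linear assocA). Qed.
Let R0 al : R al 0 = 0.
Proof. exact/linear_map_0/(rbf_R_linear rbfA). Qed.
Let RD al : {morph R al : x y / x + y}.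
Proof. exact/linear_map_add/(rbf_R_linear rbfA). Qed.

(** Constant series have no coefficient of t, and [p], [q] are constant in t, so
the degree 1 can only be taken in one of the two multiplications on each
side. *)
Lemma deformation_delta2_Alg al be ga a b c :
  delta2_Alg mu p q (mut 1) al be ga a b c = 0.
Proof.
have /(congr1 (fun s : fps A => fcoef s 1)) :=
  bho_assoc (rbf_assoc (def_RBF deformA)) al be ga (fpsC a) (fpsC b) (fpsC c).
rewrite !fps_coef01 !(def_mu0 deformA) p0 q0 !(mu0l, mu0r) !(addr0, add0r).
rewrite /delta2_Alg => E.
by rewrite [X in X - _]addrAC E addrK subrr.
Qed.

(** The weight is constant in t as well, so the degree 1 falls either on the
multiplication, giving [Phi2], or on one occurrence of the Rota-Baxter
operator, giving [partial1]; additivity of [R] separates the two inside the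
right-hand side. *)
Lemma deformation_partial1_Phi2 al be a b :
  - partial1 lambda mu R (Rt 1) al be a b - Phi2 lambda R (mut 1) al be a b = 0.
Proof.
have /(congr1 (fun s : fps A => fcoef s 1)) :=
  rbf_RB (def_RBF deformA) al be (fpsC a) (fpsC b).
rewrite !fps_coef01 !(def_mu0 deformA) !(def_R0 deformA).
rewrite !R0 !(mu0l, mu0r) !(addr0, add0r) !RD => /eqP.
rewrite [mu al be (R al a) b + _]addrC.
rewrite -subr_eq0 => E; apply/eqP; rewrite -opprD oppr_eq0 /partial1 /Phi2 !RD.
move: E; rewrite !opprD !addrA.
(* Both sides are now signed sums of the same nine terms, in different orders. *)
by rewrite [X in X == 0](ACl (1*6*9*2*4*3*8*5*7)).
Qed.

End Infinitesimal.

Theorem proposition4p7 (k : comPzRingType) (Omega : monoidType)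
    (A : lmodType k) (lambda : k)
    (mu : Omega -> Omega -> A -> A -> A) (R p q : Omega -> A -> A)
    (mut : nat -> Omega -> Omega -> A -> A -> A)
    (Rt : nat -> Omega -> A -> A) :
  is_RBF_BiHomOmega_assoc lambda mu R p q ->
  is_formal_deformation lambda mu R p q mut Rt ->
  is_2cocycle_RBFA lambda mu R p q (mut 1) (Rt 1).
Proof.
move=> rbfA deformA; split.
- exact: (def_mu_C2 deformA).
- exact: (def_R_C1 deformA).
- exact: deformation_delta2_Alg rbfA deformA.
- exact: deformation_partial1_Phi2 rbfA deformA.
Qed.
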